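(* Every finite group is $k$-fold OD-characterizable for some natural number $k$. That is, for every finite group $M$ there is an integer $k\geqslant 1$ such that $h_{\mathrm{OD}}(M)=k$.
   Context: For a finite group $G$, $\pi(G)$ is the set of primes dividing $|G|$. The Gruenberg-Kegel graph (prime graph) $\mathrm{GK}(G)$ is the simple graph with vertex set $\pi(G)$ in which two distinct primes $p,q$ are adjacent if and only if $G$ contains an element of order $pq$. For $p\in\pi(G)$, $\deg_G(p)$ is the degree of the vertex $p$ in $\mathrm{GK}(G)$. If $\pi(G)=\{p_1<p_2<\cdots<p_h\}$, the degree pattern of $G$ is the tuple $\mathrm{D}(G)=(\deg_G(p_1),\deg_G(p_2),\ldots,\deg_G(p_h))$. For a finite group $M$, $h_{\mathrm{OD}}(M)$ is the number of isomorphism classes of finite groups $G$ with $|G|=|M|$ and $\mathrm{D}(G)=\mathrm{D}(M)$; $M$ is called $k$-fold OD-characterizable if $h_{\mathrm{OD}}(M)=k$. *)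

(* Defs.v *)
From HB Require Import structures.
From mathcomp Require Import all_boot all_order all_fingroup.

Set Implicit Arguments.
Unset Strict Implicit.
Unset Printing Implicit Defensive.

Local Open Scope group_scope.

Definition GK_adj (gT : finGroupType) (G : {group gT}) : rel nat :=
  fun p q => [&& p \in primes #|G|, q \in primes #|G|, p != q
               & [exists x in G, #[x] == (p * q)%N]].

Definition GK_deg (gT : finGroupType) (G : {group gT}) (p : nat) : nat :=
  count (GK_adj G p) (primes #|G|).

(* [primes n] lists the prime divisors of n in increasing order. *)
Definition degree_pattern (gT : finGroupType) (G : {group gT}) : seq nat :=
  [seq GK_deg G p | p <- primes #|G|].

Definition same_OD (gT rT : finGroupType) (M : {group gT}) (G : {group rT})
    : Prop :=
  #|G| = #|M| /\ degree_pattern G = degree_pattern M.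

(* "The finite groups satisfying P form exactly k isomorphism classes": the   *)
(* groups [set: F i], i < k, represent every class once.  This is a relation  *)
(* rather than a nat-valued function because the number of classes is not     *)
(* finite for an arbitrary P; num_iso_classes_inj shows it is single-valued.  *)
Definition num_iso_classes (P : forall gT : finGroupType, {group gT} -> Prop)
    (k : nat) : Prop :=
  exists F : 'I_k -> finGroupType,
    [/\ forall i, P (F i) [set: F i]%G,
        forall i j, [set: F i] \isog [set: F j] -> i = j
      & forall (gT : finGroupType) (G : {group gT}),
          P gT G -> exists i, G \isog [set: F i]].

Lemma num_iso_classes_inj P k l :
  num_iso_classes P k -> num_iso_classes P l -> k = l.
Proof.
suff le m n : num_iso_classes P m -> num_iso_classes P n -> m <= n.
  by move=> Pk Pl; apply/eqP; rewrite eqn_leq !le.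
move=> [F [PF injF _]] [F' [_ _ surjF']].
pose R i j := [set: F i] \isog [set: F' j].
have exR i : exists j, R i j by apply: surjF'.
pose f i := xchoose (exR i).
have injf : injective f.
  move=> i j eq_f; apply: injF.
  have Ri : R i (f i) := xchooseP (exR i).
  have Rj : R j (f j) := xchooseP (exR j).
  by apply: isog_trans Ri _; rewrite eq_f isog_sym.
by have := leq_card f injf; rewrite !card_ord.
Qed.

(* [h_OD M k] reads h_OD(M) = k. *)
Definition h_OD (gT : finGroupType) (M : {group gT}) (k : nat) : Prop :=
  num_iso_classes (fun rT (G : {group rT}) => same_OD M G) k.

Definition OD_characterizable (k : nat) (gT : finGroupType) (M : {group gT})
    : Prop :=
  h_OD M k.

(* Main.v *)
(** By Cayley's theorem every group of order [n] is isomorphic to a subgroup of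
    ['S_n], so the groups of order [n] with a given degree pattern form finitely
    many isomorphism classes; [M] belongs to one of them, so there is at least
    one. *)
Require Import Defs.
From mathcomp Require Import all_boot all_order all_fingroup.

Set Implicit Arguments.
Unset Strict Implicit.
Unset Printing Implicit Defensive.

Local Open Scope group_scope.

(** The right regular representation is faithful. The degree [n] is tied to [#|aT|] only by an
    equation, so that provably equal cardinals can be exchanged in the type ['S_n]. *)
Lemma isog_Sym_setT (aT : finGroupType) (n : nat) :
  #|aT| = n -> exists H : {group 'S_n}, [set: aT] \isog H.
Proof.
(* Right translation by [x], carried over to ordinals by the enumeration of [aT]. *)
move=> <-; pose r (x : aT) (i : 'I_#|aT|) := enum_rank (enum_val i * x).
have r_inj x : injective (r x).
  by move=> i j /enum_rank_inj/mulIg/enum_val_inj.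
pose f x : 'S_#|aT| := perm (@r_inj x).
have fM : {in [set: aT] &, {morph f : x y / x * y}}.
  by move=> x y _ _; apply/permP=> i; rewrite permM !permE /r enum_rankK mulgA.
pose fm := Morphism fM.
exists (fm @* [set: aT])%G; apply: sub_isog => //.
(* A translation is determined by its value at the identity. *)
apply/injmP=> x y _ _ /permP/(_ (enum_rank 1)).
by rewrite !permE /r enum_rankK !mul1g => /enum_rank_inj.
Qed.

Lemma isog_Sym (gT : finGroupType) (G : {group gT}) :
  exists H : {group 'S_#|G|}, G \isog H.
Proof.
(* Passing to [subg_of G] makes the degree [#|G|] rather than [#|gT|]. *)
have card_subg : #|subg_of G| = #|G| by rewrite -cardsT (card_isog (isog_subg G)).
have [H isoH] := isog_Sym_setT card_subg.
by exists H; apply: isog_trans (isog_subg G) isoH.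
Qed.

(** Every class meets the finite type [{group 'S_n}], where the boolean [p] decides [P]; one
    canonical subgroup is kept per class. *)
Lemma num_iso_classes_exists (P : forall gT : finGroupType, {group gT} -> Prop)
    (n : nat) (p : pred {group 'S_n}) :
    (forall H, reflect (P _ H) (p H)) ->
    (forall (gT rT : finGroupType) (G : {group gT}) (H : {group rT}),
      G \isog H -> P gT G -> P rT H) ->
    (forall (gT : finGroupType) (G : {group gT}), P gT G -> #|G| = n) ->
  exists k, num_iso_classes P k.
Proof.
move=> pP Piso Pn.
(* [pick] depends only on the extension of its predicate, hence on the class of [H]. The default is
   never reached, since [H] itself qualifies. *)
pose rep (H : {group 'S_n}) := odflt H [pick K : {group 'S_n} | K \isog H].
have isog_rep H : rep H \isog H.
  by rewrite /rep; case: pickP => // _; apply: isog_refl.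
have rep_isog (H K : {group 'S_n}) : H \isog K -> rep H = rep K.
  move=> isoHK; rewrite /rep.
  have eqHK : (fun L : {group 'S_n} => L \isog H) =1 (fun L => L \isog K).
    by move=> L; apply: isog_transr.
  by rewrite (eq_pick eqHK); case: pickP => // /(_ K); rewrite isog_refl.
(* The fixed points of [rep] form a transversal of the classes. *)
pose A := [set H | p H && (rep H == H)].
exists #|A|, (fun i : 'I_#|A| => subg_of (enum_val i)); split=> [i | i j iso_ij | gT G PG].
- have := enum_valP i; rewrite inE => /andP[/pP PH _].
  exact: Piso (isog_subg _) PH.
- have := enum_valP i; have := enum_valP j; rewrite !inE.
  move=> /andP[_ /eqP repj] /andP[_ /eqP repi].
  apply: enum_val_inj; rewrite -repi -repj; apply: rep_isog.
  apply: isog_trans (isog_subg _) (isog_trans iso_ij _).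
  by rewrite isog_sym isog_subg.
have [H isoGH] : exists H : {group 'S_n}, G \isog H.
  by rewrite -(Pn _ _ PG); apply: isog_Sym.
have isoGr : G \isog rep H by apply: isog_trans isoGH _; rewrite isog_sym.
have Ar : rep H \in A.
  rewrite inE (rep_isog _ _ (isog_rep H)) eqxx andbT.
  by apply/pP; apply: Piso PG.
exists (enum_rank_in Ar (rep H)); rewrite enum_rankK_in //.
exact: isog_trans isoGr (isog_subg _).
Qed.

(** Injective morphisms preserve element orders; this makes adjacency in the prime graph an
    isomorphism invariant. *)
Lemma isog_exists_order (gT rT : finGroupType) (G : {group gT})
    (H : {group rT}) (m : nat) :
  G \isog H -> [exists x in G, #[x] == m] = [exists x in H, #[x] == m].
Proof.
case/isogP=> f injf <-; apply/exists_inP/exists_inP=> [[x Gx ox] | [y]].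
  by exists (f x); rewrite ?mem_morphim ?order_injm.
by case/morphimP=> x _ Gx ->; rewrite order_injm // => ox; exists x.
Qed.

Lemma isog_degree_pattern (gT rT : finGroupType) (G : {group gT})
    (H : {group rT}) :
  G \isog H -> degree_pattern G = degree_pattern H.
Proof.
move=> isoGH; rewrite /degree_pattern (card_isog isoGH).
apply: eq_map => p; rewrite /GK_deg (card_isog isoGH); apply: eq_count => q.
by rewrite /GK_adj (card_isog isoGH) (isog_exists_order _ isoGH).
Qed.

Theorem theorem1p1 (gT : finGroupType) (M : {group gT}) :
  exists k : nat, 1 <= k /\ OD_characterizable k M.
Proof.
have [k Mk] : exists k, h_OD M k.
  apply: (@num_iso_classes_exists _ #|M|
    (fun H => (#|H| == #|M|) && (degree_pattern H == degree_pattern M))).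
  - by move=> H; apply: (iffP andP) => [] [/eqP ? /eqP ?].
  - move=> rT sT G H isoGH [oG dG]; split; first by rewrite -(card_isog isoGH).
    by rewrite -(isog_degree_pattern isoGH).
  - by move=> rT G [].
(* The class of [M] itself has an index in ['I_k], which forces [k] to be positive. *)
exists k; split=> //; have [F [_ _ /(_ _ M)[]]] := Mk; first by [].
by case=> i lt_ik _; apply: leq_trans lt_ik.
Qed.
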